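(* Let $n\in\mathbb{N}$, let $\mathbf{s}=(s_0,\ldots,s_n)\subset[0,\infty)$ be strictly positive on $(0,1]$ and let $s_{-1}\in[0,\infty)$. Then $\mathbf{s}'=(s_{-1},s_0,\ldots,s_n)$ (viewed as a sequence of length $n+2$ with $s_{-1}$ as its zeroth term) is strictly positive on $(0,1]$ if and only if $s_{-1}\in(t_1(\mathbf{s}),\infty)$.
   Context: For $a<b$ and $\mathbf{s}=(s_0,\ldots,s_n)$ let $\sigma(x^k)=s_k$ define a linear functional on real polynomials of degree $\le n$. $\mathbf{s}$ is positive on $[a,b]$ if $\sigma(P)\ge0$ for every such $P$ nonnegative on $[a,b]$, strictly positive if moreover $\sigma(P)>0$ for every such $P\not\equiv0$. Strictly positive on $(0,1]$ means strictly positive on some $[a,b]$ with $0<a<b\le1$. $\mathcal{M}_{a,b}(\mathbf{s})$ is the set of positive Borel measures on $[a,b]$ with $k$-th moments $s_k$ ($k=0,\ldots,n$); $t_{a,b}(\mathbf{s})=\inf\{\int_{[a,b]}\frac1t\,d\mu:\mu\in\mathcal{M}_{a,b}(\mathbf{s})\}$ with $\inf\varnothing=\infty$, and $t_1(\mathbf{s})=\inf_{0<a<b\le1}t_{a,b}(\mathbf{s})$. *)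

(* Defs.v *)
From HB Require Import structures.
From mathcomp Require Import all_boot all_order all_algebra.
From mathcomp Require Import all_classical all_reals all_analysis.
Set Implicit Arguments. Unset Strict Implicit. Unset Printing Implicit Defensive.
Import Order.TTheory GRing.Theory Num.Theory.
Local Open Scope classical_set_scope.
Local Open Scope ring_scope.

(* A finite sequence s = (s_0,...,s_n) is represented by s : nat -> R, of
   which only the values s 0, ..., s n matter. *)

Definition sigma_fun {R : realType} (n : nat) (s : nat -> R) (p : {poly R}) : R :=
  \sum_(k < n.+1) p`_k * s k.

Definition positive_on {R : realType} (n : nat) (s : nat -> R) (a b : R) : Prop :=
  forall p : {poly R}, (size p <= n.+1)%N ->
    (forall x, a <= x <= b -> 0 <= p.[x]) -> 0 <= sigma_fun n s p.

Definition strictly_positive_on {R : realType} (n : nat) (s : nat -> R) (a b : R) : Prop :=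
  positive_on n s a b /\
  forall p : {poly R}, (size p <= n.+1)%N ->
    (forall x, a <= x <= b -> 0 <= p.[x]) -> p != 0 -> 0 < sigma_fun n s p.

Definition strictly_positive_01 {R : realType} (n : nat) (s : nat -> R) : Prop :=
  exists a b : R, [/\ 0 < a, a < b, b <= 1 & strictly_positive_on n s a b].

(* M_{a,b}(s): positive Borel measures on [a,b] (represented as Borel measures
   on R vanishing outside [a,b]) whose k-th moments are s_k, k = 0..n. *)
Definition moment_measures {R : realType} (n : nat) (s : nat -> R) (a b : R)
  : set {measure set R -> \bar R} :=
  [set mu | mu (~` `[a, b]) = 0%E /\
            forall k, (k <= n)%N ->
              (\int[mu]_(x in `[a, b]) ((x ^+ k)%:E) = (s k)%:E)%E].

(* t_{a,b}(s) = inf { int 1/t dmu : mu in M_{a,b}(s) }, inf of empty = +oo *)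
Definition t_ab {R : realType} (n : nat) (s : nat -> R) (a b : R) : \bar R :=
  ereal_inf [set (\int[mu]_(x in `[a, b]) ((x^-1)%:E))%E
            | mu in moment_measures n s a b].

Definition t_1 {R : realType} (n : nat) (s : nat -> R) : \bar R :=
  ereal_inf [set t_ab n s ab.1 ab.2 | ab in [set ab : R * R |
              0 < ab.1 /\ ab.1 < ab.2 /\ ab.2 <= 1]].

Definition shift_seq {R : realType} (sm1 : R) (s : nat -> R) : nat -> R :=
  fun k => if k is k'.+1 then s k' else sm1.

(* Main.v *)
(* Write L for the functional of s' and split P = P(0) + x Q, so that
   L(P) = s_{-1} P(0) + sigma(Q).

   If mu represents s on [a,b] and c = \int 1/t dmu < s_{-1}, then
   L(P) = (s_{-1} - c) P(0) + \int P/t dmu.  For P <> 0 nonnegative on (0,1] this is positive: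
   clearly if P(0) > 0, and if P(0) = 0 because then L(P) = sigma(Q) with Q >= 0 on (0,1].
   By compactness of the unit sphere of polynomials, finitely many points of (0,1] already
   force positivity, hence L is strictly positive on [a',1] for some a' > 0.

   Conversely, if L is strictly positive on [a,b], the same compactness argument gives eps > 0
   and finitely many x_i in [a,b] such that L(P) - eps P(0) >= 0 as soon as all P(x_i) >= 0.
   By Farkas' lemma L(P) - eps P(0) = \sum_i w_i P(x_i) with w_i >= 0, and the measure
   \sum_i w_i x_i delta_{x_i} represents s with \int 1/t = s_{-1} - eps. *)

Require Import Defs.
From HB Require Import structures.
From mathcomp Require Import all_boot all_order all_algebra.
From mathcomp Require Import finmap.
From mathcomp Require Import all_classical all_reals all_analysis.
From mathcomp Require Import measurable_realfun.
From mathcomp Require Import ring lra.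
Import Order.TTheory GRing.Theory Num.Theory.
Import numFieldNormedType.Exports.
Local Open Scope classical_set_scope.
Local Open Scope ring_scope.

(** * Farkas' lemma for finitely many linear functionals *)

(* Bartl's induction: a vector [z] violating the conclusion for the first [m] functionals
   yields the projection [v + f m v *: z] onto the kernel of the last one. *)
Lemma farkas (F : realFieldType) (V : lmodType F) (m : nat) (f : nat -> V -> F) (g : V -> F) :
  (forall i, scalar (f i)) -> scalar g ->
  (forall v, (forall i, (i < m)%N -> 0 <= f i v) -> 0 <= g v) ->
  exists2 w : nat -> F, (forall i, 0 <= w i) &
    forall v, g v = \sum_(i < m) w i * f i v.
Proof.
have sc0 (h : V -> F) : scalar h -> h 0 = 0.
  by move=> hl; have := hl (-1) 0 0; rewrite scaler0 addr0; lra.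
have scZ (h : V -> F) a u : scalar h -> h (a *: u) = a * h u.
  by move=> hl; rewrite -[a *: u]addr0 hl (sc0 h hl) addr0.
elim: m f g => [|m IHm] f g fl gl fg.
  exists (fun=> 0) => // v; rewrite big_ord0; apply/eqP; rewrite eq_le fg// andbT.
  have : 0 <= g ((-1) *: v) by apply: fg.
  by rewrite scZ//; lra.
have [fg'|] := pselect (forall v, (forall i, (i < m)%N -> 0 <= f i v) -> 0 <= g v).
  have [w w0 gE] := IHm f g fl gl fg'.
  exists (fun i => if (i < m)%N then w i else 0) => [i|v]; first by case: ifP.
  rewrite big_ord_recr/= ltnn mul0r addr0 gE; apply: eq_bigr => i _.
  by rewrite ltn_ord.
move=> /existsNP[z0 /not_implyP[z0ge0 /negP]]; rewrite -ltNge => gz0.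
have fz0 : f m z0 < 0.
  rewrite ltNge; apply/negP => fm0; suff : 0 <= g z0 by rewrite leNgt gz0.
  by apply: fg => i; rewrite ltnS leq_eqVlt => /orP[/eqP->//|/z0ge0].
(* Scaling to [f m z = -1] puts [f m v *: z + v] in the kernel of [f m]. *)
pose z := (- (f m z0)^-1) *: z0.
have c0 : 0 < - (f m z0)^-1 by rewrite oppr_gt0 invr_lt0.
have fmz : f m z = -1 by rewrite scZ// mulNr mulVf// lt_eqF.
have gz : g z < 0 by rewrite scZ// pmulr_rlt0.
have fz i : (i < m)%N -> 0 <= f i z.
  by move=> im; rewrite scZ// mulr_ge0 ?z0ge0// ltW.
pose f' i v := f i v + f i z * f m v.
pose g' v := g v + g z * f m v.
have projE (h : V -> F) v : scalar h -> h v + h z * f m v = h (f m v *: z + v).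
  by move=> hl; rewrite hl; ring.
have [w w0 gE] : exists2 w : nat -> F, (forall i, 0 <= w i) &
    forall v, g' v = \sum_(i < m) w i * f' i v.
  apply: IHm => [i a u v|a u v|v vge0].
  - by rewrite /f' !fl; ring.
  - by rewrite /g' gl fl; ring.
  rewrite /g' projE//; apply: fg => i; rewrite ltnS leq_eqVlt => /orP[/eqP->|im].
    by rewrite fl fmz mulrN1 addNr.
  by rewrite -projE// vge0.
(* The last weight comes from expanding [g = g' - g z * f m] in terms of the [f i]; it is
   nonnegative because [g z < 0 <= f j z]. *)
exists (fun i => if (i < m)%N then w i
         else \sum_(j < m) w j * f j z - g z) => [i|v].
  case: ifP => // _; rewrite subr_ge0 (le_trans (ltW gz))// sumr_ge0// => j _.
  by rewrite mulr_ge0 ?fz.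
rewrite big_ord_recr/= ltnn.
have -> : g v = g' v - g z * f m v by rewrite /g'; ring.
rewrite gE mulrBl addrA; congr (_ - _).
rewrite mulr_suml -big_split/=; apply: eq_bigr => i _.
by rewrite ltn_ord /f'; ring.
Qed.

(** * Compactness: finitely many constraints suffice *)

Lemma continuous_dot (R : realType) (d : nat) (e : 'I_d -> R) :
  continuous (fun v : 'rV[R]_d => \sum_k v ord0 k * e k).
Proof.
apply: continuous_big => [|k _ v]; first exact: add_continuous.
by apply: continuousM; [exact: coord_continuous|exact: cst_continuous].
Qed.

(* Compactness of the unit sphere: it is covered by the open sets
   [e x < 0] for [x] in [X] and [eps < l] for [eps > 0]. *)
Lemma finite_strict_positivity (R : realType) (T : choiceType) (d : nat) (X : set T)
    (e : T -> 'I_d -> R) (l : 'I_d -> R) : X !=set0 ->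
  (forall v : 'rV[R]_d, v != 0 ->
     (forall x, X x -> 0 <= \sum_k v ord0 k * e x k) ->
     0 < \sum_k v ord0 k * l k) ->
  exists2 xs : seq T, (forall x, x \in xs -> X x) &
  exists2 eps : R, 0 < eps &
    forall v : 'rV[R]_d, (forall x, x \in xs -> 0 <= \sum_k v ord0 k * e x k) ->
      eps * `|v| <= \sum_k v ord0 k * l k.
Proof.
move=> [x0 Xx0] posl.
pose K := [set v : 'rV[R]_d | `|v| = 1].
have cK : compact K.
  apply: bounded_closed_compact.
    by exists 1; split; [exact: num_real|move=> y y1 v /= ->; exact: ltW].
  have -> : K = Num.norm @^-1` [set 1 : R] by [].
  by apply: closed_comp => // v _; exact: norm_continuous.
pose D := [set p : T * R | X p.1 /\ 0 < p.2].
pose U (p : T * R) := [set v : 'rV[R]_d | \sum_k v ord0 k * e p.1 k < 0] `|`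
                      [set v : 'rV[R]_d | p.2 < \sum_k v ord0 k * l k].
have opU p : D p -> open (U p).
  move=> _; apply: openU.
    apply: (@open_comp _ _ (fun v : 'rV[R]_d => \sum_k v ord0 k * e p.1 k)
      [set y | y < 0]); [by move=> v _; exact: continuous_dot|exact: open_lt].
  apply: (@open_comp _ _ (fun v : 'rV[R]_d => \sum_k v ord0 k * l k)
    [set y | p.2 < y]); [by move=> v _; exact: continuous_dot|exact: open_gt].
have covU : K `<=` cover D U.
  move=> v /= v1.
  have v0 : v != 0 by rewrite -normr_gt0 v1.
  have [[x [Xx xv]]|nx] :=
      pselect (exists x, X x /\ \sum_k v ord0 k * e x k < 0).
    by exists (x, 1); [split => //=|left].
  (* Only the second open set matters here, so [x0] is a filler; halving makes the inequality
     strict. *)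
  exists (x0, (\sum_k v ord0 k * l k) / 2).
    split => //=; rewrite divr_gt0//; apply: posl => // x Xx.
    by rewrite leNgt; apply/negP => xv; apply: nx; exists x.
  right => /=; have : 0 < \sum_k v ord0 k * l k.
    apply: posl => // x Xx; rewrite leNgt; apply/negP => xv; apply: nx; by exists x.
  by lra.
move: cK; rewrite compact_cover => /(_ _ D U opU covU)[G GD covG].
exists [seq p.1 | p <- enum_fset G] => [x /mapP[p pG ->]|].
  by have := GD p pG; rewrite inE => -[].
(* The default 1 keeps the minimum positive when [G] is empty. *)
exists (\big[Order.min/1]_(p <- enum_fset G) p.2).
  rewrite big_seq; apply: (big_ind (fun y => 0 < y)) => // [x y x0' y0|p pG].
    by rewrite lt_min x0'.
  by have := GD p pG; rewrite inE => -[].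
move=> v vge0; have [->|v0] := eqVneq v 0.
  by rewrite normr0 mulr0 big1// => k _; rewrite mxE mul0r.
have nv0 : 0 < `|v| by rewrite normr_gt0.
have dotE (u : 'I_d -> R) :
    \sum_k (`|v|^-1 *: v) ord0 k * u k = `|v|^-1 * \sum_k v ord0 k * u k.
  by rewrite mulr_sumr; apply: eq_bigr => k _; rewrite mxE mulrA.
(* By homogeneity it suffices to treat [v] rescaled to the sphere, where some member of the finite
   cover contains it. *)
have /covG[p /= pG] : K (`|v|^-1 *: v).
  by rewrite /K /= normrZ normfV normr_id mulVf// gt_eqF.
rewrite /U /= !dotE => -[|].
  rewrite ltNge mulr_ge0// ?invr_ge0//; apply: vge0; exact: map_f.
move=> /ltW pl; rewrite -ler_pdivlMr// mulrC; apply: le_trans pl.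
exact: ge_bigmin_seq.
Qed.

(** * Integrals against measures on [[a, b]] *)

Lemma measurable_invr_itvcc (R : realType) (a b : R) : 0 < a ->
  measurable_fun `[a, b] (fun x : R => x^-1).
Proof.
move=> a0; have mV : measurable_fun (`]0, +oo[ : set R) (fun x : R => x^-1).
  apply: open_continuous_measurable_fun; first exact: interval_open.
  move=> x; rewrite inE/= in_itv/= andbT => x0.
  by apply: cvgV => //; rewrite gt_eqF.
apply: measurable_funS mV => // x /=.
by rewrite !in_itv/= andbT => /andP[+ _]; exact: lt_le_trans.
Qed.

Lemma integral_atomic (R : realType) (m : nat) (w : nat -> {nonneg R}) (x : nat -> R)
    (D : set R) (f : R -> R) : measurable D -> (forall i, D (x i)) ->
  (forall y, D y -> 0 <= f y) -> measurable_fun D f ->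
  (\int[msum (fun i => mscale (w i) \d_(x i)) m]_(y in D) (f y)%:E =
     (\sum_(i < m) (w i)%:num * f (x i))%:E)%E.
Proof.
move=> mD Dx f0 mf; have mf' : measurable_fun D (EFin \o f) by exact/measurable_EFinP.
rewrite ge0_integral_measure_sum//.
rewrite -sumEFin; apply: eq_bigr => i _.
rewrite ge0_integral_mscale//.
by rewrite integral_dirac//= diracE mem_set// mul1e EFinM.
Qed.

(* [shift_seq x^-1 (fun j => x ^+ j) k] is [x ^ (k - 1)], so the moments [s] of [mu] are the
   moments of index [>= 1] of the measure [x^-1 dmu], whose mass is [c]. *)
Lemma positive_on_shift (R : realType) (n : nat) (s : nat -> R) (a b c : R)
    (mu : {measure set R -> \bar R}) : 0 < a -> moment_measures n s a b mu ->
  (\int[mu]_(x in `[a, b]) (x^-1)%:E = c%:E)%E ->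
  positive_on n.+1 (shift_seq c s) a b.
Proof.
move=> a0 [_ mus] muc p sp p0.
have mD : measurable (`[a, b] : set R) by [].
pose h (k : 'I_n.+2) (x : R) := shift_seq x^-1 (fun j => x ^+ j) k.
have h0 k x : `[a, b]%classic x -> 0 <= h k x.
  rewrite /= in_itv/= => /andP[/(lt_le_trans a0)/ltW x0 _].
  by rewrite /h; case: k => -[|k] /= _; rewrite ?invr_ge0// exprn_ge0.
have mh k : measurable_fun `[a, b] (h k).
  rewrite /h; case: k => -[|k] /= _; first exact: measurable_invr_itvcc.
  exact: exprn_measurable.
have intE k : (\int[mu]_(x in `[a, b]) (h k x)%:E = (shift_seq c s k)%:E)%E.
  rewrite /h; case: k => -[|k] /= kn; first exact: muc.
  exact: mus.
have inth k : mu.-integrable `[a, b] (EFin \o h k).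
  apply/integrableP; split; first exact/measurable_EFinP.
  rewrite (_ : integral _ _ _ = (shift_seq c s k)%:E) ?ltry// -intE.
  by apply: eq_integral => x; rewrite inE => /(h0 k) hx; rewrite /= ger0_norm.
(* The integrand is [p.[x] / x]; integrating it term by term gives the functional of the shifted
   sequence. *)
suff : (0 <= \int[mu]_(x in `[a, b])
    (\sum_(k < n.+2) (p`_k)%:E * (h k x)%:E))%E.
  rewrite integral_sum//; last first.
    by move=> k; exact: (integrableZl mD _ (inth k)).
  have ZE (k : 'I_n.+2) : (\int[mu]_(x in `[a, b]) ((p`_k)%:E * (h k x)%:E) =
      (p`_k * shift_seq c s k)%:E)%E.
    by rewrite EFinM -intE; exact: (integralZl mD (inth k)).
  under eq_bigr do rewrite ZE.
  by rewrite sumEFin lee_fin.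
apply: integral_ge0 => x /=; rewrite in_itv/= => /[dup] xab /andP[ax _].
have x0 : 0 < x := lt_le_trans a0 ax.
under eq_bigr do rewrite -EFinM.
rewrite sumEFin lee_fin -(pmulr_rge0 _ x0).
suff -> : x * (\sum_(k < n.+2) p`_k * h k x) = p.[x] by exact: p0.
rewrite (horner_coef_wide _ sp) mulr_sumr; apply: eq_bigr => -[[|k] kn] _; rewrite /h /=.
  by rewrite mulrCA divff ?gt_eqF.
by rewrite exprS; ring.
Qed.

(** * Strict positivity of polynomial functionals *)

(** By continuity, a negative value at 0 would persist at small positive points. *)
Lemma horner0_ge0 (R : realType) (p : {poly R}) :
  (forall x, 0 < x <= 1 -> 0 <= p.[x]) -> 0 <= p.[0].
Proof.
move=> p0; rewrite leNgt; apply/negP => np0.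
have pc : p.[x] @[x --> (0:R)^'+] --> p.[0].
  by apply: cvg_at_right_filter; exact: continuous_horner.
have : \forall x \near (0:R)^'+, [&& 0 < x, x < 1 & p.[x] < 0].
  near=> x; apply/and3P; split; near: x; last exact: (cvgr_lt _ pc).
    exact: nbhs_right_gt.
  exact: nbhs_right_lt.
move=> /filter_ex[x /and3P[x0 x1]]; rewrite ltNge p0// x0 /=; exact: ltW.
Unshelve. all: by end_near. Qed.

Lemma coord_le_norm (R : realType) (m d : nat) (v : 'M[R]_(m, d)) i j : `|v i j| <= `|v|.
Proof.
rewrite {2}/Num.norm/= mx_normrE.
exact: (@le_bigmax _ _ _ 0 (fun ij => `|v ij.1 ij.2|) (i, j)).
Qed.

(** Transfers the compactness result to polynomials through their coefficient vectors: evaluation at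
    [x] is the dot product with the powers of [x]. *)
Lemma finite_strict_positivity_poly (R : realType) (N : nat) (s : nat -> R) (X : set R) :
  X !=set0 ->
  (forall p : {poly R}, (size p <= N.+1)%N -> (forall x, X x -> 0 <= p.[x]) -> p != 0 ->
     0 < sigma_fun N s p) ->
  exists2 xs : seq R, (forall x, x \in xs -> X x) &
  exists2 eps : R, 0 < eps &
    forall p : {poly R}, (size p <= N.+1)%N -> (forall x, x \in xs -> 0 <= p.[x]) ->
      eps * `|poly_rV p : 'rV[R]_N.+1| <= sigma_fun N s p.
Proof.
move=> X0 sp.
have [|xs xsX [eps eps0 H]] := @finite_strict_positivity R R N.+1 X
    (fun x k => x ^+ k) (fun k => s k) X0.
  move=> v v0 vge0; have := sp (rVpoly v) (size_poly _ _).
  rewrite /sigma_fun; under eq_bigr do rewrite coef_rVpoly_ord.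
  apply; last by apply: contra v0 => /eqP v0; rewrite -[v]rVpolyK v0 linear0.
  move=> x Xx; rewrite (horner_coef_wide _ (size_poly _ _)).
  by under eq_bigr do rewrite coef_rVpoly_ord; exact: vge0.
exists xs => //; exists eps => // p pN p0.
have coefE k : (poly_rV p : 'rV[R]_N.+1) ord0 k = p`_k by rewrite mxE.
have := H (poly_rV p); under eq_bigr do rewrite coefE.
apply=> x xxs; under eq_bigr do rewrite coefE.
by rewrite -(horner_coef_wide _ pN); exact: p0.
Qed.

(** Farkas' lemma represents the functional minus [eps] times evaluation at 0 by point evaluations;
    only the moment of index 0 feels the correction. *)
Lemma strictly_positive_quadrature (R : realType) (N : nat) (s : nat -> R) (a b : R) :
  a <= b -> strictly_positive_on N s a b ->
  exists m (x w : nat -> R) (eps : R),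
    [/\ 0 < eps, forall i, a <= x i <= b, forall i, 0 <= w i &
        forall k, (k <= N)%N -> \sum_(i < m) w i * x i ^+ k = s k - (k == 0)%:R * eps].
Proof.
move=> ab [_ sp].
have [||xs xsab [eps eps0 H]] := @finite_strict_positivity_poly R N s [set x | a <= x <= b].
- by exists a; rewrite /= lexx.
- exact: sp.
(* The default [a] keeps [x i] in the interval for every index. *)
pose x i := nth a xs i.
pose f i (v : 'rV[R]_N.+1) := (rVpoly v).[x i].
pose g (v : 'rV[R]_N.+1) := sigma_fun N s (rVpoly v) - eps * v ord0 ord0.
have [|||w w0 gE] := @farkas R 'rV[R]_N.+1 (size xs) f g.
- by move=> i c u v; rewrite /f linearP hornerD hornerZ.
- move=> c u v; rewrite /g /sigma_fun linearP !mxE.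
  under eq_bigr do rewrite coefD coefZ mulrDl -mulrA.
  by rewrite big_split/= -mulr_sumr; ring.
(* The constant coefficient is at most the norm of the coefficient vector, which the compactness
   bound controls. *)
- move=> v fv; rewrite /g subr_ge0.
  apply: le_trans (H (rVpoly v) (size_poly _ _) _); last first.
    move=> y yxs; have := fv (index y xs); rewrite index_mem => /(_ yxs).
    by rewrite /f /x nth_index.
  by rewrite rVpolyK ler_pM2l// (le_trans (ler_norm _))// coord_le_norm.
exists (size xs), x, w, eps; split => //.
  move=> i; rewrite /x; have [xi|xi] := ltnP i (size xs).
    exact: xsab (mem_nth a xi).
  by rewrite nth_default// lexx.
(* Testing the identity on monomials yields the moments. *)
move=> k kN; have Xk : (size ('X^k : {poly R}) <= N.+1)%N by rewrite size_polyXn.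
have := gE (poly_rV 'X^k); rewrite /g /f mxE poly_rV_K// coefXn.
under [in RHS]eq_bigr do rewrite hornerXn.
move=> <-; rewrite eq_sym mulrC; congr (_ - _).
rewrite /sigma_fun (bigD1 (Ordinal (kN : (k < N.+1)%N)))//= big1 => [|j jk].
  by rewrite coefXn eqxx mul1r addr0.
by rewrite coefXn -[X in (X == _)]/(val j) (negbTE (_ : val j != k)) ?mul0r.
Qed.

Lemma strictly_positive_01_itvoc (R : realType) (N : nat) (s : nat -> R) :
  (forall p : {poly R}, (size p <= N.+1)%N -> p != 0 ->
    (forall x, 0 < x <= 1 -> 0 <= p.[x]) -> 0 < sigma_fun N s p) ->
  strictly_positive_01 N s.
Proof.
move=> sp.
have [||xs xs01 [eps eps0 H]] := @finite_strict_positivity_poly R N s [set x | 0 < x <= 1].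
- by exists 1; rewrite /= ltr01 lexx.
- by move=> p pN p0 pn0; exact: sp.
(* All the points lie in [[a, 1]]; the default 1/2 forces [a < 1] even if 1 is the only point. *)
pose a := \big[Order.min/2^-1]_(x <- xs) x.
have a0 : 0 < a.
  rewrite /a big_seq; apply: (big_ind (fun y => 0 < y)) => [|x y x0 y0|x /xs01].
  - by rewrite invr_gt0.
  - by rewrite lt_min x0.
  - by move=> /andP[].
have a1 : a < 1.
  by rewrite (le_lt_trans (bigmin_le_id _ _ _ _))// invf_lt1// ltr1n.
have key (p : {poly R}) : (size p <= N.+1)%N ->
    (forall x, a <= x <= 1 -> 0 <= p.[x]) ->
    eps * `|poly_rV p : 'rV[R]_N.+1| <= sigma_fun N s p.
  move=> pN p0; apply: H => // x xxs; apply: p0.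
  by have /andP[_ ->] := xs01 _ xxs; rewrite andbT; exact: ge_bigmin_seq.
exists a, 1; split => //; split => p pN p0.
  by apply: le_trans (key p pN p0); rewrite mulr_ge0// ltW.
move=> pn0; apply: lt_le_trans (key p pN p0); rewrite mulr_gt0// normr_gt0.
by apply: contra pn0 => /eqP pr; rewrite -(poly_rV_K pN) pr linear0.
Qed.

(** * The two implications *)

Lemma t_1_lt (R : realType) (n : nat) (s : nat -> R) (c : R) :
  strictly_positive_01 n.+1 (shift_seq c s) -> (t_1 n s < c%:E)%E.
Proof.
move=> [a [b [a0 ab b1 /(strictly_positive_quadrature _ _ _ _ _ (ltW ab))]]].
move=> [m [x [w [eps [eps0 xab w0 wE]]]]].
have x0 i : 0 < x i by have /andP[/(lt_le_trans a0)] := xab i.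
have wx0 i : 0 <= w i * x i by rewrite mulr_ge0// ltW.
have xabD i : `[a, b]%classic (x i) by rewrite /= in_itv xab.
(* The factor [x i] lowers indices by one: moment [k] of [mu] is quadrature moment [k.+1], and the
   integral of [y^-1] is quadrature moment 0. *)
pose mu : {measure set R -> \bar R} :=
  msum (fun i => mscale (NngNum (wx0 i)) \d_(x i)) m.
have abge0 y : `[a, b]%classic y -> 0 < y.
  by rewrite /= in_itv/= => /andP[/(lt_le_trans a0)].
have mu_s : moment_measures n s a b mu.
  split.
    rewrite /mu/= /msum big1// => i _; rewrite /= /mscale/= diracE memNset ?mule0//.
    by move=> /(_ (xabD i)).
  move=> k kn; rewrite /mu (@integral_atomic _ _ _ _ _ (fun y => y ^+ k))//.
  - have := wE k.+1 kn; rewrite /= mul0r subr0 => <-; congr (_%:E).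
    by apply: eq_bigr => i _; rewrite /= exprS mulrA.
  - by move=> y /abge0/ltW; exact: exprn_ge0.
have muV : (\int[mu]_(y in `[a, b]) (y^-1)%:E = (c - eps)%:E)%E.
  rewrite /mu (@integral_atomic _ _ _ _ _ (fun y => y^-1))//.
  - have := wE 0%N isT; rewrite /= mul1r => <-; congr (_%:E).
    by apply: eq_bigr => i _; rewrite /= mulfK ?gt_eqF// expr0 mulr1.
  - by move=> y /abge0/ltW; rewrite invr_ge0.
  - exact: measurable_invr_itvcc.
apply: (@le_lt_trans _ _ (c - eps)%:E); last by rewrite lte_fin gtrBl.
rewrite -muV; apply: (@le_trans _ _ (t_ab n s a b)); apply: ereal_inf_lbound.
  by exists (a, b).
by exists mu.
Qed.

Lemma shift_strictly_positive (R : realType) (n : nat) (s : nat -> R) (c : R) :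
  strictly_positive_01 n s -> (t_1 n s < c%:E)%E ->
  strictly_positive_01 n.+1 (shift_seq c s).
Proof.
move=> [a0 [b0 [a00 ab0 b01 [_ sp]]]].
move=> /ereal_inf_lt[_ [[a b] /= [a_gt0 [ab b1]] <-]].
move=> /ereal_inf_lt[_ [mu mus <-] muc].
have muV0 : (0 <= \int[mu]_(x in `[a, b]) (x^-1)%:E)%E.
  apply: integral_ge0 => x /=; rewrite in_itv/= => /andP[/(lt_le_trans a_gt0)/ltW x0 _].
  by rewrite lee_fin invr_ge0.
(* The integral is nonnegative and below [c], hence a real number [t]. *)
move: muc muV0; case muV : (\int[mu]_(x in `[a, b]) (x^-1)%:E)%E => [t| |] //.
rewrite lte_fin => tc _.
have post := positive_on_shift _ _ _ _ _ _ _ a_gt0 mus muV.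
have sigmaE u p : sigma_fun n.+1 (shift_seq u s) p = p`_0 * u + sigma_fun n s (drop_poly 1 p).
  rewrite /sigma_fun big_ord_recl/=; congr (_ + _); apply: eq_bigr => k _.
  by rewrite coef_drop_poly addn1.
apply: strictly_positive_01_itvoc => p pn p0 pge0.
have : 0 <= p`_0 by rewrite -horner_coef0; exact: horner0_ge0.
rewrite le_eqVlt => /predU1P[p00|p0_gt0]; last first.
  have : 0 <= sigma_fun n.+1 (shift_seq t s) p.
    apply: post => // x /andP[ax xb]; apply: pge0.
    by rewrite (lt_le_trans a_gt0 ax) (le_trans xb b1).
  (* Replacing [t] by [c] raises the functional by [p.[0] * (c - t) > 0]. *)
  rewrite !sigmaE; have : p`_0 * t < p`_0 * c by rewrite ltr_pM2l.
  by lra.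
rewrite sigmaE -p00 mul0r add0r.
(* With zero constant term, [p] is ['X] times a quotient that is nonnegative on [[a0, b0]], where
   strict positivity of [s] applies. *)
have pE : p = drop_poly 1 p * 'X.
  rewrite -[LHS](poly_take_drop 1) expr1 [take_poly _ _](_ : _ = 0) ?add0r//.
  by apply/polyP => -[|k]; rewrite coef_take_poly coef0 -?p00.
apply: sp.
- by rewrite size_drop_poly leq_subLR add1n.
- move=> x /andP[ax xb]; have x0 : 0 < x := lt_le_trans a00 ax.
  rewrite -(pmulr_lge0 _ x0) -hornerMX -pE; apply: pge0.
  by rewrite x0 (le_trans xb).
- by apply: contra p0 => /eqP q0; rewrite pE q0 mul0r.
Qed.

Theorem theorem8p4 (R : realType) (n : nat) (s : nat -> R) (sm1 : R)
  (hs0 : forall k, (k <= n)%N -> 0 <= s k)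
  (hs : strictly_positive_01 n s)
  (hsm1 : 0 <= sm1) :
  strictly_positive_01 n.+1 (shift_seq sm1 s) <-> (t_1 n s < sm1%:E)%E.
Proof. by split; [exact: t_1_lt|exact: shift_strictly_positive]. Qed.
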